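(* Let $\kappa$ be an uncountable cardinal and let $G$ be a limit of regular representations of length $\kappa$ with countable base. Then $$|Aut(G)|=\beth_{\kappa+1}.$$
   Context: A group is the limit of regular representations of length $\kappa$ with base $G_0$ (where $|G_0|\ge 3$ is assumed throughout) if it is the direct limit of the directed system $\{G_\alpha\}_{\alpha<\kappa}$ where $G_{\alpha+1}=Sym(G_\alpha)$ and $G_\alpha\hookrightarrow G_{\alpha+1}$ via its right regular representation for all $\alpha<\kappa$, and $G_\gamma=\varinjlim_{\alpha<\gamma}G_\alpha$ for all limit $\gamma<\kappa$. Countable means finite or countably infinite. The beth numbers are $\beth_0=\aleph_0$, $\beth_{\alpha+1}=2^{\beth_\alpha}$ for all $\alpha$, and $\beth_\gamma=\sup\{\beth_\alpha:\alpha<\gamma\}$ for limit $\gamma$. *)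

(* Defs.v *)
From HB Require Import structures.
From mathcomp Require Import all_boot.
From mathcomp Require Import boolp classical_sets functions cardinality wochoice.

Set Implicit Arguments.
Unset Strict Implicit.
Unset Printing Implicit Defensive.

Local Open Scope classical_set_scope.
Local Open Scope card_scope.
Local Open Scope group_scope.

(* An ordinal is represented by a well-ordered type of that order type; the
   ordinals below it are the elements of the type. *)
Record wordinal := WOrdinal {
  wcar :> Type;
  wle : rel wcar;
  wle_wo : well_order wle }.
Arguments wle {w}.

Section WOrdinal.
Variable alpha : wordinal.
Implicit Types a b c : alpha.

Definition wlt a b : Prop := wle a b /\ a <> b.

Definition is_zero a : Prop := forall b, wle a b.

Definition is_succ a b : Prop := wlt a b /\ forall c, wlt a c -> wle b c.

Definition is_limit c : Prop := ~ is_zero c /\ ~ exists a, is_succ a c.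

End WOrdinal.

(* alpha + 1: a new greatest element [None] is added, so that the ordinals
   [<= alpha] are the elements of [osucc alpha], with [alpha] itself being
   [None]. *)
Definition osucc_le (alpha : wordinal) : rel (option alpha) := fun x y =>
  match x, y with
  | _, None => true
  | Some a, Some b => wle a b
  | None, Some _ => false
  end.

Lemma osucc_wo (alpha : wordinal) : well_order (@osucc_le alpha).
Proof.
move=> A [x xA]; have [[a aA]|nA] := pselect (exists a, Some a \in A).
  have [|m [[mA mlb] mU]] := @wle_wo alpha [pred b | Some b \in A].
    by exists a.
  exists (Some m); split=> [|[b|] [bA blb]].
  - by split=> // -[b|] // bA; apply: mlb.
  - congr Some; apply: mU; split=> // c cA.
    exact: (blb (Some c) cA).
  - by have := blb _ mA.
have An y : y \in A -> y = None.
  by case: y => // y yA; case: nA; exists y.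
exists x; split=> [|y [yA _]]; last by rewrite (An _ xA) (An _ yA).
by split=> // y yA; rewrite (An _ xA) (An _ yA).
Qed.

Definition osucc (alpha : wordinal) : wordinal := WOrdinal (@osucc_wo alpha).

(* Cardinals are initial ordinals. *)
Definition uncountable_cardinal (kappa : wordinal) : Prop :=
  (forall a : kappa, ~ ([set: kappa] #= [set b : kappa | wlt b a])) /\
  ~ countable [set: kappa].

Definition is_card_sup (I : Type) (D : set I) (B : I -> Type) (X : Type) :=
  (forall i, D i -> [set: B i] #<= [set: X]) /\
  (forall Y : Type, (forall i, D i -> [set: B i] #<= [set: Y]) ->
     [set: X] #<= [set: Y]).

(* [B a] has cardinality beth_a for every ordinal [a < alpha]. *)
Record beth_family (alpha : wordinal) (B : alpha -> Type) : Prop := BethFamily {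
  beth_zero : forall a, is_zero a -> [set: B a] #= [set: nat];
  beth_succ : forall a b, is_succ a b -> [set: B b] #= [set: set (B a)];
  beth_limit : forall c, is_limit c ->
    is_card_sup [set a | wlt a c] B (B c) }.

(* #|A| = beth_alpha; the recursion is run over the ordinals [<= alpha]. *)
Definition card_eq_beth (T : Type) (A : set T) (alpha : wordinal) : Prop :=
  exists2 B : osucc alpha -> Type, beth_family B & A #= [set: B None].

Definition Sym (T : Type) := {f : T -> T | bijective f}.

Section Sym.
Variable T : Type.
Implicit Types s t u : Sym T.

HB.instance Definition _ := gen_eqMixin (Sym T).
HB.instance Definition _ := gen_choiceMixin (Sym T).

Lemma Sym_inj s t : sval s =1 sval t -> s = t.
Proof.
by case: s t => [f bf] [g bg] /= /funext fg; case: _ / fg bg => bg;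
  congr exist; apply: Prop_irrelevance.
Qed.

Definition Sym_one : Sym T := exist _ id (Bijective (fun=> erefl) (fun=> erefl)).

(* Permutations act on the right, as in perm.v: (s * t) x = t (s x).  This is
   the convention under which x |-> (y |-> y * x) is a homomorphism. *)
Definition Sym_mul s t : Sym T :=
  exist _ (sval t \o sval s) (bij_comp (svalP t) (svalP s)).

Lemma Sym_inv_subproof s : {g : T -> T | cancel (sval s) g & cancel g (sval s)}.
Proof. by apply: cid2; case: (svalP s) => g; exists g. Qed.

Definition Sym_inv s : Sym T :=
  exist _ (s2val (Sym_inv_subproof s))
    (Bijective (s2valP' (Sym_inv_subproof s)) (s2valP (Sym_inv_subproof s))).

Lemma Sym_mulA : associative Sym_mul.
Proof. by move=> s t u; apply: Sym_inj. Qed.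

Lemma Sym_mul1 : left_id Sym_one Sym_mul.
Proof. by move=> s; apply: Sym_inj. Qed.

Lemma Sym_mulr1 : right_id Sym_one Sym_mul.
Proof. by move=> s; apply: Sym_inj. Qed.

Lemma Sym_mulV : left_inverse Sym_one Sym_inv Sym_mul.
Proof.
by move=> s; apply: Sym_inj => x /=; rewrite (s2valP' (Sym_inv_subproof s)).
Qed.

Lemma Sym_mulrV : right_inverse Sym_one Sym_inv Sym_mul.
Proof.
by move=> s; apply: Sym_inj => x /=; rewrite (s2valP (Sym_inv_subproof s)).
Qed.

HB.instance Definition _ :=
  isGroup.Build (Sym T) Sym_mulA Sym_mul1 Sym_mulr1 Sym_mulV Sym_mulrV.

End Sym.

Section RightRegular.
Variable G : groupType.

Definition right_regular (x : G) : Sym G :=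
  exist _ (fun y => y * x) (Bijective (mulgK x) (mulgVK x)).

Lemma right_regularM : {morph right_regular : x y / x * y}.
Proof. by move=> x y; apply: Sym_inj => z /=; rewrite mulgA. Qed.

HB.instance Definition _ :=
  isMultiplicative.Build G (Sym G) right_regular right_regularM.

End RightRegular.

Record directed_system (I : wordinal) := DirectedSystem {
  dgrp :> I -> groupType;
  dmap : forall a b : I, wle a b -> {multiplicative dgrp a -> dgrp b};
  dmap_id : forall (a : I) (aa : wle a a) x, dmap aa x = x;
  dmap_comp : forall (a b c : I) (ab : wle a b) (bc : wle b c) (ac : wle a c) x,
    dmap bc (dmap ab x) = dmap ac x }.

Section DirectLimit.
Variables (I : wordinal) (S : directed_system I) (D : set I).

Definition is_cocone (L : groupType)
    (g : forall a, D a -> {multiplicative S a -> L}) : Prop :=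
  forall a b (Da : D a) (Db : D b) (ab : wle a b) x,
    g b Db (dmap S ab x) = g a Da x.

(* [L], with the maps [g], is the direct limit in the category of groups of the
   restriction of [S] to [D]. *)
Definition is_direct_limit (L : groupType)
    (g : forall a, D a -> {multiplicative S a -> L}) : Prop :=
  is_cocone g /\
  forall (H : groupType) (h : forall a, D a -> {multiplicative S a -> H}),
    is_cocone h ->
    (exists u : {multiplicative L -> H},
       forall a (Da : D a) x, u (g a Da x) = h a Da x) /\
    (forall u v : {multiplicative L -> H},
       (forall a (Da : D a) x, u (g a Da x) = h a Da x) ->
       (forall a (Da : D a) x, v (g a Da x) = h a Da x) ->
       u =1 v).

End DirectLimit.

(* The equalities between groups are read up to isomorphisms compatible with
   the transition maps. *)
Record regular_rep_system (kappa : wordinal) (G0 : groupType)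
    (S : directed_system kappa) : Prop := RegularRepSystem {
  rrs_zero : forall a, is_zero a ->
    exists phi : {multiplicative S a -> G0}, bijective phi;
  rrs_succ : forall a b (ab : wle a b), is_succ a b ->
    exists2 phi : {multiplicative S b -> Sym (S a)}, bijective phi &
      forall x, phi (dmap S ab x) = right_regular x;
  rrs_limit : forall c, is_limit c ->
    @is_direct_limit kappa S [set a | wlt a c] (S c)
      (fun a (ac : wlt a c) => dmap S (proj1 ac)) }.

Definition limit_of_regular_reps (kappa : wordinal) (G0 G : groupType) : Prop :=
  exists2 S : directed_system kappa, regular_rep_system G0 S &
    exists g : forall a, [set: kappa] a -> {multiplicative S a -> G},
      is_direct_limit g.

Definition AutG (G : groupType) : set (G -> G) :=
  [set f | bijective f /\ {morph f : x y / x * y}].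
Arguments AutG : clear implicits.

(* Main.v *)
(* Write B_a for a type of cardinality beth_a.  The transition maps of the
   system are injective, and each successor stage is the symmetric group of the
   previous one, so |S (a + 1)| = 2 ^ |S a| once S a is infinite.  Induction
   gives |S a| <= B_a and, for a strictly increasing f : kappa -> kappa with
   infinite stages S (f a), B_a <= |S (f a)|; such an f exists because kappa is
   an uncountable cardinal.  Hence |G| = beth_kappa and
   |Aut G| <= |G| ^ |G| = beth_(kappa + 1).

   Conversely, every automorphism phi of S a extends to S (a + 1) = Sym (S a)
   in |S a| ways, namely as the conjugations by x |-> phi (t * x) with t in S a:
   left translations centralize the right regular representation, and
   distinct t give distinct conjugations as Sym (S a) has trivial center.
   Unions are forced at limit stages, so Aut G contains a copy of
   prod_(a < kappa) S a.  A subset A of G is determined by its traces on the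
   infinite stages S a, each of which can be coded by an element of S (a + 1);
   so this product has at least 2 ^ |G| elements. *)
From HB Require Import structures.
Require Import Defs.
From mathcomp Require Import all_boot.
From mathcomp Require Import boolp classical_sets functions cardinality wochoice.

Set Implicit Arguments.
Unset Strict Implicit.
Unset Printing Implicit Defensive.

Local Open Scope classical_set_scope.
Local Open Scope card_scope.
Local Open Scope group_scope.

(** * Embeddings between types *)

Lemma sval_inj (T : Type) (P : T -> Prop) : injective (@sval T P).
Proof.
by move=> [x Px] [y Py] /= E; case: _ / E Py => Py; congr exist;
  apply: Prop_irrelevance.
Qed.

(** Cardinals are compared through plain injections between types, since segments, stages and beths
    are all types; [emb_cardP] links this to [#<=]. *)
Definition emb (T U : Type) : Prop := exists f : T -> U, injective f.

Lemma emb_refl T : emb T T. Proof. by exists id. Qed.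

Lemma emb_trans U T V : emb T U -> emb U V -> emb T V.
Proof. by move=> [f fi] [g gi]; exists (g \o f); apply: inj_comp. Qed.

Lemma emb_cardP T U : emb T U <-> [set: T] #<= [set: U].
Proof.
split=> [[f fi]|/card_leP[f]].
  suff /injfunPex[f'] : exists2 g :
    T -> U, set_fun setT setT g & set_inj setT g.
    exact: inj_card_le f'.
  by exists f => // x y _ _; apply: fi.
exists (fun x => val (f (exist _ x (mem_set I)))) => x y /val_inj xy.
by have /(congr1 val) := 'inj_f (mem_set I) (mem_set I) xy.
Qed.

Lemma emb_card_eq T U : emb T U -> emb U T -> [set: T] #= [set: U].
Proof. by move=> /emb_cardP ? /emb_cardP ?; apply: Cantor_Bernstein. Qed.

Lemma emb_bij T U : emb T U -> emb U T -> exists f : T -> U, bijective f.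
Proof.
move=> TU UT; have /card_bijP[f [g fK gK]] := emb_card_eq TU UT.
pose s V (x : V) : [set: V] := exist _ x (mem_set I).
have vK V (x : [set: V]) : s V (val x) = x by apply: val_inj.
by exists (fun x => val (f (s _ x))), (fun y => val (g (s _ y))) => x;
  rewrite vK ?fK ?gK.
Qed.

Lemma surj_emb T U (f : T -> U) : (forall y, exists x, f x = y) -> emb U T.
Proof.
move=> /choice[g gK]; exists g; exact: can_inj gK.
Qed.

Lemma emb_set T U : emb T U -> emb (set T) (set U).
Proof.
move=> [f fi]; exists (fun A => f @` A) => A B AB; apply/seteqP; split=> x.
  by move=> Ax; have : (f @` A) (f x) by [exists x];
    rewrite AB => -[y By /fi<-].
by move=> Ax; have : (f @` B) (f x) by [exists x]; rewrite -AB => -[y By /fi<-].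
Qed.

Lemma emb_setr T : emb T (set T).
Proof.
by exists set1 => x y xy; have : [set x] x by []; rewrite xy.
Qed.

(** Diagonal argument: the set of all [f B] lying outside [B] both contains and omits its own
    code. *)
Lemma Cantor T : ~ emb (set T) T.
Proof.
move=> [f fi]; pose A x := exists2 B, f B = x & ~ B x.
have [AfA|nA] := pselect (A (f A)).
  by have [B /fi-> ] := AfA; apply.
by apply: (nA); exists A.
Qed.

Lemma emb_prod T T' U U' : emb T T' -> emb U U' -> emb (T * U) (T' * U').
Proof.
move=> [f fi] [g gi]; exists (fun p => (f p.1, g p.2)) => -[a b] [c d] /= [].
by move=> /fi-> /gi->.
Qed.

Lemma emb_sum T T' U U' : emb T T' -> emb U U' -> emb (T + U) (T' + U').
Proof.
move=> [f fi] [g gi].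
exists (fun p => match p with inl a => inl (f a) | inr b => inr (g b) end).
by case=> [a|a] [b|b] //= [] => [/fi->|/gi->].
Qed.

Lemma emb_sum_double T : emb (T + T) (bool * T).
Proof.
exists (fun p => match p with inl a => (true, a) | inr b => (false, b) end).
by case=> [a|a] [b|b] //= [] ->.
Qed.

Lemma emb_bool_nat : emb bool nat.
Proof. by exists nat_of_bool; case; case. Qed.

(* The graph of an injection of [A * A] into [A], where
   [A = [set x | exists z, F (x, x, z)]]. *)
Record square_graph X (F : set (X * X * X)) : Prop := SquareGraph {
  sq_fun : forall p z z', F (p, z) -> F (p, z') -> z = z';
  sq_inj : forall p p' z, F (p, z) -> F (p', z) -> p = p';
  sq_tot : forall x y u v, F (x, x, u) -> F (y, y, v) -> exists z, F (x, y, z);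
  sq_dom : forall x y z, F (x, y, z) ->
    exists u v w, [/\ F (x, x, u), F (y, y, v) & F (z, z, w)] }.

(** Each axiom of a square graph starts from at most two triples, so it may be checked in a square
    subgraph containing both. This handles unions of chains. *)
Lemma square_graphP X (F : set (X * X * X)) :
  (forall s t, F s -> F t ->
    exists H, [/\ square_graph H, H `<=` F, H s & H t]) -> square_graph F.
Proof.
move=> FH; split.
- by move=> p z z' Fz Fz'; have [H [gH _ ]] := FH _ _ Fz Fz'; apply: sq_fun.
- by move=> p p' z Fz Fz'; have [H [gH _ ]] := FH _ _ Fz Fz'; apply: sq_inj.
- move=> x y u v Fx Fy; have [H [gH HF Hx Hy]] := FH _ _ Fx Fy.
  by have [z /HF] := sq_tot gH Hx Hy; exists z.
- move=> x y z Fx; have [H [gH HF Hx _]] := FH _ _ Fx Fx.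
  by have [u [v [w [/HF ? /HF ? /HF ?]]]] := sq_dom gH Hx; exists u, v, w.
Qed.

(** The seed for Zorn's lemma: a pairing function on [nat], transported along an injection into
    [X]. *)
Lemma infinite_square_graph X : emb nat X ->
  exists F : set (X * X * X), square_graph F /\
    emb nat {x | exists z, F (x, x, z)}.
Proof.
move=> [i ii].
have [k ki] : emb (nat * nat) nat.
  by apply/emb_cardP; have := card_nat2; move/card_eqPle => -[].
exists [set t | exists m n, t = (i m, i n, i (k (m, n)))]; split.
  split.
  - by move=> p z z' [m [n [-> ->]]] [m' [n' [/ii-> /ii-> ->]]].
  - by move=> p p' z [m [n [-> ->]]] [m' [n' [-> /ii/ki [-> ->]]]].
  - move=> x y u v [m [? [-> _ _]]] [n [? [-> _ _]]].
    by exists (i (k (m, n))), m, n.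
  - move=> _ _ _ [m [n [-> -> ->]]].
    exists (i (k (m, m))), (i (k (n, n))), (i (k (k (m, n), k (m, n)))).
    by split; [exists m, m|exists n, n|exists (k (m, n)), (k (m, n))].
by exists (fun n => exist _ (i n) (ex_intro _ (i (k (n, n)))
   (ex_intro _ n (ex_intro _ n erefl)))) => m n [] /ii.
Qed.

(** * Enlarging the domain of a square graph *)

Section SquareExtension.
Variables (X : Type) (F : set (X * X * X)).
Hypothesis gF : square_graph F.
Let A := [set x | exists z, F (x, x, z)].
Hypothesis natA : emb nat {x | A x}.

Let sq_spec : {f : X -> X -> X | forall x y, A x -> A y -> F (x, y, f x y)}.
Proof.
apply: cid.
have: forall p : X * X, exists z, A p.1 -> A p.2 -> F (p.1, p.2, z).
  move=> [x y] /=; have [[Ax Ay]|nA] := pselect (A x /\ A y).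
    have [[u xu] [v yv]] := (Ax, Ay); have [z] := sq_tot gF xu yv.
    by exists z.
  (* Outside [A] the value is arbitrary; [x] is a default. *)
  by exists x => Ax Ay; case: nA.
case/choice => f fP; exists (fun x y => f (x, y)) => x y Ax Ay.
exact: (fP (x, y)).
Qed.
Let f := sval sq_spec.

Let fF x y : A x -> A y -> F (x, y, f x y). Proof. exact: (svalP sq_spec). Qed.

Let fA x y : A x -> A y -> A (f x y).
Proof.
move=> Ax Ay; have [_ [_ [w [_ _ ?]]]] := sq_dom gF (fF Ax Ay).
by exists w.
Qed.

Let FA x y z : F (x, y, z) -> [/\ A x, A y, A z & z = f x y].
Proof.
move=> xyz; have [u [v [w [xu yv zw]]]] := sq_dom gF xyz.
have [Ax Ay] : A x /\ A y by split; [exists u|exists v].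
split=> //; first by exists w.
exact: (sq_fun gF xyz (fF Ax Ay)).
Qed.

Let f_inj x y x' y' : A x -> A y -> A x' -> A y' -> f x y = f x' y' ->
  x = x' /\ y = y'.
Proof.
move=> Ax Ay Ax' Ay' E; have := fF Ax Ay; rewrite E => H.
by have [-> ->] := sq_inj gF H (fF Ax' Ay').
Qed.

Lemma square_graph_dom : emb ({x | A x} * {x | A x}) {x | A x}.
Proof.
exists (fun p => exist A (f (sval p.1) (sval p.2)) (fA (svalP p.1) (svalP
  p.2))).
move=> [[x Ax] [y Ay]] [[x' Ax'] [y' Ay']] [] /= /f_inj [] // xx yy.
by congr pair; apply: sval_inj.
Qed.

Variable j : X -> X.
Hypothesis jA : forall x, A x -> ~ A (j x).
Hypothesis j_inj : forall x y, A x -> A y -> j x = j y -> x = y.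

(** The new domain is [A] together with its disjoint copy [j A]. A pair with some coordinate in the
    copy is sent into the copy: the two underlying elements of [A] are paired by [f], paired again
    with a tag in [A] recording which coordinates are copies, and the result is moved by [j]. *)
Lemma square_graph_ext : exists F', square_graph F' /\ F `<` F'.
Proof.
(* Four distinct tags in [A], indexed by two bits read in binary. *)
have [e eA e_inj] : exists2 e :
  bool * bool -> X, (forall p, A (e p)) & injective e.
  have [i ii] := natA;
    exists (fun p : bool * bool =>
      sval (i (2 * nat_of_bool p.1 + nat_of_bool p.2)%N)).
    by move=> p; apply: svalP.
  move=> p q /sval_inj/ii; by case: p q => [[] []] [[] []].
pose v (b : bool) a := if b then j a else a.
have v_inj b b' a a' : A a -> A a' -> v b a = v b' a' -> b = b' /\ a = a'.
  move=> Aa Aa'; case: b; case: b' => /= E; split=> //; try exact: j_inj.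
  - by case: (jA Aa); rewrite E.
  - by case: (jA Aa); rewrite E.
  - by case: (jA Aa'); rewrite -E.
  - by case: (jA Aa'); rewrite -E.
pose N := [set t | exists b b' a a', [/\ A a, A a', b || b' &
  t = (v b a, v b' a', j (f (f a a') (e (b, b'))))]].
have NA b b' a a' : A a -> A a' -> b || b' ->
    N (v b a, v b' a', j (f (f a a') (e (b, b')))).
  by move=> ? ? ?; exists b, b', a, a'.
have F'A b b' a a' : A a -> A a' -> exists z, (F `|` N) (v b a, v b' a', z).
  move=> Aa Aa'; case: (boolP (b || b')) => [bb|].
    by eexists; right; apply: NA.
  by rewrite negb_or => /andP[/negbTE-> /negbTE->]; exists (f a a'); left;
    apply: fF.
have F'dom x y z : (F `|` N) (x, y, z) -> exists b b' b'' a a' a'',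
    [/\ x = v b a, y = v b' a', z = v b'' a'' & [/\ A a, A a' & A a'']].
  move=> [/FA[Ax Ay Az _]|]; first by exists false, false, false, x, y, z.
  move=> [b [b' [a [a' [Aa Aa' bb [-> -> ->]]]]]].
  exists b, b', true, a, a', (f (f a a') (e (b, b'))); split=> //.
  by split=> //; apply: fA; [apply: fA|apply: eA].
exists (F `|` N); split; last first.
  split; first by move=> t; left.
  (* The extension is proper: it has a triple starting with [j a], which is not in [A]. *)
  have [i _] := natA; have [a Aa] := i 0%N => FN.
  have /FN : (F `|` N) (v true a, v false a, j (f (f a a) (e (true, false)))).
    by right; apply: NA.
  by move=> /FA[/(jA Aa)].
split.
- move=> [x y] z z' [F1|N1] [F2|N2].
  + exact: (sq_fun gF F1 F2).
  + have [Ax Ay _ _] := FA F1;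
      case: N2 => b [b' [a [a' [Aa Aa' bb [Ex Ey _]]]]].
    have [? _] := @v_inj false b x a Ax Aa Ex.
    by have [? _] := @v_inj false b' y a' Ay Aa' Ey; subst.
  + have [Ax Ay _ _] := FA F2;
      case: N1 => b [b' [a [a' [Aa Aa' bb [Ex Ey _]]]]].
    have [? _] := @v_inj false b x a Ax Aa Ex.
    by have [? _] := @v_inj false b' y a' Ay Aa' Ey; subst.
  + case: N1 => b [b' [a [a' [Aa Aa' bb [Ex Ey ->]]]]].
    case: N2 => c [c' [d [d' [Ad Ad' cc [Ex' Ey' ->]]]]].
    rewrite Ex in Ex'; rewrite Ey in Ey'.
    have [-> ->] := v_inj _ _ _ _ Aa Ad Ex'.
    by have [-> ->] := v_inj _ _ _ _ Aa' Ad' Ey'.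
(* An old and a new triple never share a value: old values lie in [A], new ones outside. *)
- move=> p p' z [F1|N1] [F2|N2].
  + exact: (sq_inj gF F1 F2).
  + case: p F1 => x y /FA[_ _ Az _].
    case: N2 Az => b [b' [a [a' [Aa Aa' bb [_ ->]]]]] Az.
    by case: (jA (fA (fA Aa Aa') (eA _)) Az).
  + case: p' F2 => x y /FA[_ _ Az _].
    case: N1 Az => b [b' [a [a' [Aa Aa' bb [_ ->]]]]] Az.
    by case: (jA (fA (fA Aa Aa') (eA _)) Az).
  + case: N1 => b [b' [a [a' [Aa Aa' bb [-> Ez]]]]].
    case: N2 => c [c' [d [d' [Ad Ad' cc [-> E]]]]]; rewrite Ez in E.
    have {E} := j_inj (fA (fA Aa Aa') (eA _)) (fA (fA Ad Ad') (eA _)) E.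
    move=> /(f_inj (fA Aa Aa') (eA _) (fA Ad Ad') (eA _)) [E /e_inj[-> ->]].
    by have [-> ->] := f_inj Aa Aa' Ad Ad' E.
- move=> x y u w /F'dom[b [_ [_ [a [_ [_ [-> _ _ [Aa _ _]]]]]]]].
  move=> /F'dom[b' [_ [_ [a' [_ [_ [-> _ _ [Aa' _ _]]]]]]]].
  exact: F'A.
- move=> x y z /F'dom[b [b' [b'' [a [a' [a'' [-> -> -> [Aa Aa' Aa'']]]]]]]].
  have [u ?] := F'A b b a a Aa Aa; have [w ?] := F'A b' b' a' a' Aa' Aa'.
  have [t ?] := F'A b'' b'' a'' a'' Aa'' Aa''.
  by exists u, w, t.
Qed.

End SquareExtension.

(** * Well-orders *)

Section WellOrder.
Variable alpha : wordinal.
Implicit Types (a b c : alpha) (P : set alpha).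

Lemma wo_min P : P !=set0 -> exists m, P m /\ forall b, P b -> wle m b.
Proof.
move=> [x Px]; have [|m [[mP mlb] _]] := @wle_wo alpha [pred b | `[< P b >]].
  by exists x; apply/asboolP.
exists m; split; first exact/asboolP.
by move=> b Pb; apply: mlb; apply/asboolP.
Qed.

(** The order laws are not fields of [well_order]; they are read off from least elements of sets of
    two or three points. *)
Lemma wle_total a b : wle a b || wle b a.
Proof.
have [|m [[->|->] mm]] := @wo_min (fun x => x = a \/ x = b); first by exists a;
  left.
  by rewrite mm //; right.
by rewrite (mm a) ?orbT //; left.
Qed.

Lemma wle_refl a : wle a a.
Proof. by have := wle_total a a; rewrite orbb. Qed.

(** Both points are least in the pair they form, and [well_order] makes the least element unique. *)
Lemma wle_anti a b : wle a b -> wle b a -> a = b.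
Proof.
move=> ab ba; have [|m [_ U]] := @wle_wo alpha [pred c | `[< c = a \/ c = b >]].
  by exists a; apply/asboolP; left.
have <- : m = a.
  apply: U; split; first by apply/asboolP; left.
  by move=> c /asboolP[]->; rewrite ?wle_refl.
apply: U; split; first by apply/asboolP; right.
by move=> c /asboolP[]->; rewrite ?wle_refl.
Qed.

Lemma wle_trans b a c : wle a b -> wle b c -> wle a c.
Proof.
move=> ab bc.
have [|m [[-> | [->|->]] mm]] := @wo_min (fun x => x = a \/ x = b \/ x = c).
- by exists a; left.
- by apply: mm; right; right.
- by rewrite (@wle_anti a b) //; apply: mm; left.
- by rewrite -(@wle_anti b c) //; apply: mm; right; left.
Qed.

Lemma wltW a b : wlt a b -> wle a b. Proof. by case. Qed.

Lemma wlt_irr a : ~ wlt a a. Proof. by case. Qed.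

Lemma wlt_le_trans b a c : wlt a b -> wle b c -> wlt a c.
Proof.
move=> [ab nab] bc; split; first exact: wle_trans bc.
by move=> ac; subst; apply: nab; apply: wle_anti.
Qed.

Lemma wle_lt_trans b a c : wle a b -> wlt b c -> wlt a c.
Proof.
move=> ab [bc nbc]; split; first exact: wle_trans bc.
by move=> ac; subst; apply: nbc; apply: wle_anti.
Qed.

Lemma wlt_trans b a c : wlt a b -> wlt b c -> wlt a c.
Proof. by move=> /wltW; apply: wle_lt_trans. Qed.

Lemma wle_eqVlt a b : wle a b -> a = b \/ wlt a b.
Proof. by move=> ab; have [->|n] := pselect (a = b); [left|right]. Qed.

Lemma wltNge a b : wlt a b <-> ~ wle b a.
Proof.
split=> [ab ba|nba]; first by case: (wlt_irr (wlt_le_trans ab ba)).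
have := wle_total a b; case: (boolP (wle b a)) => // _; rewrite orbF => ab.
by split=> // E; subst; case: nba.
Qed.

Lemma wleNgt a b : wle a b <-> ~ wlt b a.
Proof.
split=> [ab /wltNge//|n]; apply: contrapT => n'; by apply: n; apply/wltNge.
Qed.

Lemma wle_lt_dec a b : wle a b \/ wlt b a.
Proof. by have [|/wltNge] := pselect (wle a b); [left|right]. Qed.

Lemma wlt_wf : well_founded (@wlt alpha).
Proof.
move=> a; apply: contrapT => nA.
have [|m [nm mm]] := @wo_min (fun b => ~ Acc (@wlt alpha) b); first by exists a.
apply: nm; constructor=> b bm; apply: contrapT => /mm mb.
by case/wltNge: bm.
Qed.

Lemma is_succ_le a b c : is_succ a b -> wlt c b -> wle c a.
Proof.
move=> [ab m] cb; apply/wleNgt => /m bc.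
by case: (wlt_irr (wlt_le_trans cb bc)).
Qed.

Lemma succ_exists a b : wlt a b -> exists c, is_succ a c.
Proof.
move=> ab; have [|m [am mm]] := @wo_min (fun b => wlt a b); first by exists b.
by exists m.
Qed.

Lemma is_limit_succ c a : is_limit c -> wlt a c ->
  exists b, is_succ a b /\ wlt b c.
Proof.
move=> [_ nl] ac; have [b ab] := succ_exists ac; exists b; split=> //.
split; first exact: ab.2.
by move=> bc; apply: nl; exists a; rewrite -bc.
Qed.

Lemma is_limit_gt c : is_limit c -> exists a, wlt a c.
Proof.
move=> [nz _]; apply: contrapT => n; apply: nz => b.
by apply/wleNgt => bc; apply: n; exists b.
Qed.

Lemma wzero_succ_limit a :
  [\/ is_zero a, exists b, is_succ b a | is_limit a].
Proof.
have [|nz] := pselect (is_zero a); first by constructor 1.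
have [|ns] := pselect (exists b, is_succ b a); first by constructor 2.
by constructor 3.
Qed.

Definition seg a := {b | wlt b a}.

Lemma emb_seg a b : wle a b -> emb (seg a) (seg b).
Proof.
move=> ab; exists (fun x :
  seg a => exist (fun y => wlt y b) (sval x) (wlt_le_trans (svalP x) ab)).
by move=> x y [] /sval_inj.
Qed.

End WellOrder.

Lemma greedy (I J : wordinal) (P : set J) :
  (forall (b : I) (h : seg b -> J), exists y, P y /\ forall x, h x <> y) ->
  exists g : I -> J,
    (forall b, P (g b)) /\ (forall a b, wlt a b -> wlt (g a) (g b)).
Proof.
move=> H.
have /choice[F FP] (s : {b : I & forall b', wlt b' b -> J}) : exists y,
    (P y /\ forall b' (l : wlt b' (tag s)), tagged s b' l <> y) /\
    (forall y', P y' -> (forall b' (l : wlt b' (tag s)), tagged s b' l <> y') ->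
       wle y y').
  have [|m [[Pm nm] mm]] := @wo_min J (fun y => P y /\
      forall b' (l : wlt b' (tag s)), tagged s b' l <> y).
    have [y [Py ny]] := H (tag s) (fun x => tagged s (sval x) (proj2_sig x)).
    by exists y; split=> // b' l; apply: (ny (exist _ b' l)).
  by exists m; split=> // y Py ny; apply: mm.
pose G b h := F (existT (fun b : I => forall b', wlt b' b -> J) b h).
pose g := Fix (@wlt_wf I) (fun=> J) G.
have gE b : g b = G b (fun b' _ => g b').
  apply: (Fix_eq (@wlt_wf I) (fun=> J) G) => x h h' hh'; congr (G x _).
  by apply: functional_extensionality_dep => y;
    apply: functional_extensionality_dep.
have gP b : (P (g b) /\ forall b', wlt b' b -> g b' <> g b) /\
   (forall y', P y' -> (forall b' , wlt b' b -> g b' <> y') -> wle (g b) y').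
  have := FP (existT (fun b :
    I => forall b', wlt b' b -> J) b (fun b' _ => g b')).
  by rewrite gE.
exists g; split=> [b|a b ab]; first by have [[]] := gP b.
have [[Pb nb] _] := gP b; split; last exact: nb.
have [_] := gP a; apply=> // c ca; apply: nb; exact: wlt_trans ab.
Qed.

Lemma well_orderable (T : Type) : exists I : wordinal, wcar I = T.
Proof.
pose T' : eqType := HB.pack T (gen_eqMixin T).
by have [R Rwo] := well_ordering_principle T'; exists (WOrdinal Rwo).
Qed.

Lemma strict_mono_inj (I J : wordinal) (g : I -> J) :
  (forall a b, wlt a b -> wlt (g a) (g b)) -> injective g.
Proof.
move=> gm a b E; apply: contrapT => nab.
have [/wle_eqVlt[//|/gm]|/gm] := wle_lt_dec a b; rewrite E => /wlt_irr//.
Qed.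

(** Well-order [Y] and run the greedy recursion into it. Either it never stops and injects [I], or
    it stops at some [b] where a map from [seg b] is onto [Y]. *)
Lemma seg_emb_or (I : wordinal) (Y : Type) :
  emb I Y \/ exists b : I, emb Y (seg b).
Proof.
have [J <-] := well_orderable Y.
have [H|H] := pselect (forall (b : I) (h : seg b -> J), exists y,
    setT y /\ forall x, h x <> y).
  have [g [_ /strict_mono_inj gi]] := greedy H; left; by exists g.
right; move/existsNP: H => [b /existsNP[h hs]]; exists b.
apply: (@surj_emb _ _ h) => y; apply: contrapT => n; apply: hs.
by exists y; split=> // x hx; apply: n; exists x.
Qed.

Lemma emb_total (X Y : Type) : emb X Y \/ emb Y X.
Proof.
have [I <-] := well_orderable X; have [|[b Yb]] := seg_emb_or I Y;
  first by left.
right; apply: (emb_trans Yb); exists sval; exact: sval_inj.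
Qed.

(** Take a maximal square graph, with infinite domain [A]. If the complement of [A] embeds in [A],
    then [X] embeds in [A + A], hence in [A]; otherwise [A] embeds in its complement and
    [square_graph_ext] contradicts maximality. *)
Lemma emb_square (X : Type) : emb nat X -> emb (X * X) X.
Proof.
move=> natX; have [F0 [gF0 natF0]] := infinite_square_graph natX.
(* Keeping [F0] as a fixed part makes the empty chain harmless and every domain infinite. *)
have [|F [gF maxF]] := @Zorn_bigcup _ (fun F => square_graph (F0 `|` F)).
  move=> C CP Ctot; apply: square_graphP => s t.
  have sub F : C F -> F0 `|` F `<=` F0 `|` \bigcup_(X in C) X.
    by move=> CF; apply: setUS => u Fu; exists F.
  move=> [F0s|[F CF Fs]] [F0t|[F' CF' Ft]].
  - by exists F0; split=> // u; left.
  - exists (F0 `|` F'); split; [exact: CP|exact: sub|by left|by right].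
  - exists (F0 `|` F); split; [exact: CP|exact: sub|by right|by left].
  - have [FF|FF] := Ctot _ _ CF CF'.
      exists (F0 `|` F'); split; [exact: CP|exact: sub|right;
        exact: FF|by right].
    exists (F0 `|` F); split; [exact: CP|exact: sub|by right|right; exact: FF].
pose A := {x | exists z, (F0 `|` F) (x, x, z)}.
pose Ac := {x | ~ exists z, (F0 `|` F) (x, x, z)}.
have natA : emb nat A.
  apply: (emb_trans natF0).
  have AA x : (exists z, F0 (x, x, z)) -> exists z, (F0 `|` F) (x, x, z).
    by move=> [z F0z]; exists z; left.
  exists (fun x => exist _ (sval x) (AA _ (svalP x))) => x y [] /sval_inj//.
have AAA : emb (A * A) A by exact: square_graph_dom.
have AX : emb A X by exists sval; exact: sval_inj.
have [AcA|[j ji]] := emb_total Ac A.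
  have XA : emb X A.
    apply: (@emb_trans (A + Ac)).
      exists (fun x => match pselect (exists z, (F0 `|` F) (x, x, z)) with
        | left H => inl (exist _ x H) | right H => inr (exist _ x H) end).
      by move=> x y; case: pselect => p; case: pselect => q // [].
    apply: (@emb_trans (A + A)); first exact: emb_sum (emb_refl _) AcA.
    apply: emb_trans AAA; apply: (emb_trans (emb_sum_double _)).
    apply: emb_prod (emb_refl _); exact: emb_trans emb_bool_nat natA.
  exact: emb_trans (emb_prod XA XA) (emb_trans AAA AX).
(* [j] as a map on all of [X]; the value [x] outside [A] is a default. *)
pose j' x := match pselect (exists z, (F0 `|` F) (x, x, z)) with
        | left H => sval (j (exist _ x H)) | right H => x end.
case: (@square_graph_ext _ _ gF natA j').
- by move=> x Ax; rewrite /j'; case: pselect => // H; case: (j _).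
- move=> x y Ax Ay; rewrite /j'; case: pselect => // Hx; case: pselect => // Hy.
  by move=> /sval_inj/ji[].
move=> F' [gF' [FF' F'F]]; case: (maxF F').
  split; first by move=> s Fs; apply: FF'; right.
  by move=> F'F2; apply: F'F => s F's; right; apply: F'F2.
suff -> : F0 `|` F' = F' by [].
by apply/seteqP; split=> s; [case=> // F0s; apply: FF'; left|right].
Qed.

(** * The beth hierarchy *)

Lemma existT_inj (X : Type) (Y : X -> Type) (x : X) :
  injective (existT Y x).
Proof.
move=> y z E; have := projT2_eq E.
by rewrite (Prop_irrelevance (projT1_eq E) erefl).
Qed.

Lemma emb_prod_le (X Y Z : Type) : emb nat Z -> emb X Z -> emb Y Z ->
  emb (X * Y) Z.
Proof. by move=> nZ XZ YZ; apply: emb_trans (emb_square nZ);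
  apply: emb_prod. Qed.

Lemma emb_sum_le (X Y Z : Type) : emb nat Z -> emb X Z -> emb Y Z ->
  emb (X + Y) Z.
Proof.
move=> nZ XZ YZ; apply: (emb_trans (emb_sum XZ YZ)).
apply: (emb_trans (emb_sum_double _)); apply: emb_prod_le (emb_refl _) => //.
exact: emb_trans emb_bool_nat nZ.
Qed.

Lemma emb_sigT_le (X : Type) (Y : X -> Type) (Z : Type) : emb nat Z ->
  emb X Z -> (forall x, emb (Y x) Z) -> emb {x : X & Y x} Z.
Proof.
move=> nZ XZ YZ; pose f x := sval (cid (YZ x)).
apply: emb_trans (emb_prod_le nZ XZ (emb_refl Z)).
exists (fun s => (tag s, f _ (tagged s))) => -[x y] [x' y'] /= [E].
by case: _ / E y' => y' /(svalP (cid (YZ x)))->.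
Qed.

Section Beth.
Variable alpha : wordinal.
Implicit Types a b c : alpha.

(** The closed formula: aleph_0 plus the sum over [b < a] of the powers 2 ^ beth_b. It covers zero,
    successors and limits without case distinction. *)
Definition beth_step a (B : forall b, wlt b a -> Type) : Type :=
  (nat + {x : seg a & set (B (sval x) (proj2_sig x))})%type.

Definition beth : alpha -> Type := Fix (@wlt_wf alpha) (fun=> Type) beth_step.

Lemma bethE a : beth a = (nat + {x : seg a & set (beth (sval x))})%type.
Proof.
rewrite {1}/beth Fix_eq // => x B B' BB'; congr beth_step.
by apply: functional_extensionality_dep => y;
  apply: functional_extensionality_dep.
Qed.

Lemma emb_nat_beth a : emb nat (beth a).
Proof. by rewrite bethE; exists inl => m n []. Qed.

Lemma emb_set_beth a b : wlt a b -> emb (set (beth a)) (beth b).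
Proof.
move=> ab; rewrite (bethE b).
pose y : seg b := exist _ a ab.
exists (fun A => inr (existT (fun x : seg b => set (beth (sval x))) y A)).
move=> A A' E; pose Y (x : seg b) := set (beth (sval x)).
apply: (@existT_inj _ Y y).
exact: (congr1 (fun s => if s is inr t then t else existT Y y set0) E).
Qed.

Lemma emb_beth a b : wle a b -> emb (beth a) (beth b).
Proof.
move=> /wle_eqVlt[->|ab]; first exact: emb_refl.
exact: emb_trans (emb_setr _) (emb_set_beth ab).
Qed.

Lemma emb_seg_beth a : emb (seg a) (beth a).
Proof.
rewrite bethE; exists (fun x => inr (existT (fun x :
  seg a => set (beth (sval x))) x set0)).
by move=> x y [].
Qed.

(** An infinite [Y] bounds a sum as soon as it bounds the index set and every summand, because
    [Y * Y] embeds in [Y]. *)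
Lemma beth_emb_min a (Y : Type) : emb nat Y -> emb (seg a) Y ->
  (forall b, wlt b a -> emb (set (beth b)) Y) -> emb (beth a) Y.
Proof.
move=> nY aY bY; rewrite bethE; apply: emb_sum_le => //.
by apply: emb_sigT_le => // -[b ba]; apply: bY.
Qed.

(** The indices below [b] are those below [a] and [a] itself; singletons code the former and the
    empty set the latter. The summands are power sets of beths up to [a]. *)
Lemma emb_beth_succ a b : is_succ a b -> emb (beth b) (set (beth a)).
Proof.
move=> ab; have nY := emb_trans (emb_nat_beth a) (emb_setr _).
apply: beth_emb_min => //.
  have [f fi] := emb_seg_beth a.
  have segS : emb (seg b) (option (seg a)).
    exists (fun x : seg b => match pselect (wlt (sval x) a) with
      | left H => Some (exist (fun c => wlt c a) (sval x) H) | right _ =>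
        None end).
    move=> [x xb] [y yb] /=; case: pselect => xa; case: pselect => ya // E.
      by apply: sval_inj => /=; case: E.
    have Ea c : wlt c b -> ~ wlt c a -> c = a.
      by move=> /(is_succ_le ab) /wle_eqVlt[].
    by apply: sval_inj => /=; rewrite (Ea x) // (Ea y).
  apply: (emb_trans segS);
    exists (fun o => if o is Some x then [set f x] else set0).
  have n0 T (x : T) : [set x] <> set0 by move=> E; have : [set x] x by [];
    rewrite E.
  move=> [x|] [y|] // E; first by congr Some; apply: fi;
    have : [set f y] (f y) by []; rewrite -E.
    by case: (n0 _ _ E).
  by case: (n0 _ _ (esym E)).
by move=> c /(is_succ_le ab) ca; apply: emb_set; apply: emb_beth.
Qed.

(** Otherwise [Y] embeds in some [seg b] with [b] below [c]. With [d] the successor of [b], the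
    power set of [beth b] would embed in [beth d], then in [Y], in [seg b] and in [beth b], against
    Cantor. *)
Lemma seg_emb_sup c (Y : Type) : is_limit c ->
  (forall a, wlt a c -> emb (beth a) Y) -> emb (seg c) Y.
Proof.
move=> lc BY.
have [a0 a0c] := is_limit_gt lc.
(* [seg c] with the inherited order, so that [seg_emb_or] applies to it. *)
have wo : well_order (fun x y : seg c => wle (sval x) (sval y)).
  move=> A [x xA].
  have [|m [[mc mA] mm]] :=
    @wo_min alpha (fun b => exists bc : wlt b c, exist _ b bc \in A).
    by case: x xA => b bc bA; exists b, bc.
  exists (exist _ m mc); split.
    split=> // -[y yc] yA; apply: mm; by exists yc.
  move=> [y yc] [yA ylb]; apply: sval_inj => /=; apply: wle_anti.
    by apply: mm; exists yc.
  exact: ylb mA.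
have [//|[[b bc] Yb]] := seg_emb_or (WOrdinal wo) Y.
exfalso; have [d [bd dc]] := is_limit_succ lc bc.
have segb : emb (seg (exist _ b bc : WOrdinal wo)) (seg b).
  have sub (x : seg (exist _ b bc : WOrdinal wo)) : wlt (sval (sval x)) b.
    case: x => -[x xc] [/= xb nxb]; split=> // E; apply: nxb; exact: sval_inj.
  exists (fun x => exist (fun y => wlt y b) _ (sub x)) =>
    x y [] /sval_inj /sval_inj//.
apply: (@Cantor (beth b)).
apply: (emb_trans (emb_set_beth bd.1)); apply: (emb_trans (BY _ dc)).
exact: emb_trans Yb (emb_trans segb (emb_seg_beth b)).
Qed.

Lemma beth_familyP : beth_family beth.
Proof.
split.
- move=> a a0; have na b : ~ wlt b a by apply/wleNgt.
  apply: emb_card_eq (emb_nat_beth a); apply: beth_emb_min.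
  + exact: emb_refl.
  + by exists (fun=> 0%N) => -[b ba]; case: (na b).
  + by move=> b /na.
- move=> a b ab; apply: emb_card_eq; first exact: emb_beth_succ.
  by apply: emb_set_beth; case: ab.
- move=> c lc; split=> [a /wltW ac|Y BY]; first exact/emb_cardP/emb_beth.
  have {}BY a : wlt a c -> emb (beth a) Y by move=> /BY/emb_cardP.
  have [a0 a0c] := is_limit_gt lc.
  apply/emb_cardP; apply: beth_emb_min.
  + exact: emb_trans (emb_nat_beth a0) (BY _ a0c).
  + exact: seg_emb_sup.
  (* The successor [d] of [b] is still below the limit [c], and [beth d] absorbs the power set of
     [beth b]. *)
  + move=> b bc; have [d [bd dc]] := is_limit_succ lc bc.
    exact: emb_trans (emb_set_beth bd.1) (BY _ dc).
Qed.

End Beth.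

(** * Symmetric groups *)

(** For an inhabited type this says that there are at least three points; it is vacuous on the empty
    type. *)
Definition has_third (T : Type) : Prop :=
  forall x y : T, exists z, z <> x /\ z <> y.

Lemma emb_has_third T U : emb T U -> inhabited T -> has_third T -> has_third U.
Proof.
move=> [f fi] [a] T3 u v.
have [b [ba _]] := T3 a a; have [c [ca cb]] := T3 a b.
apply: contrapT => n.
have E t : f t = u \/ f t = v.
  have [|nu] := pselect (f t = u); first by left.
  by right; apply: contrapT => nv; apply: n; exists (f t).
have ac : f c <> f a by move=> /fi.
have ab : f b <> f a by move=> /fi.
have bc : f c <> f b by move=> /fi.
by case: (E a) (E b) (E c) => Ea [] Eb [] Ec; rewrite Ea Eb Ec in ac ab bc.
Qed.

Lemma I3_has_third T : `I_3 #<= [set: T] -> has_third T.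
Proof.
move=> T3; have e : emb 'I_3 T.
  apply/emb_cardP; apply: card_le_trans T3.
  by have := @card_II 3; rewrite card_eq_sym => /card_eqPle[].
apply: (emb_has_third e); first by exists; exact: ord0.
move=> i j; have [/existsP[k /andP[/eqP ki /eqP kj]]|] :=
  boolP [exists k, (k != i) && (k != j)].
  by exists k.
by case: i => [[|[|[|//]]] ?]; case: j => [[|[|[|//]]] ?] /existsP[];
 solve [by exists (@Ordinal 3 0 isT) | by exists (@Ordinal 3 1 isT) | by exists
   (@Ordinal 3 2 isT)].
Qed.

Section Transposition.
Variables (T : Type) (x y : T).

Definition swap (t : T) : T :=
  if pselect (t = x) then y else if pselect (t = y) then x else t.

Lemma swapL : swap x = y.
Proof. by rewrite /swap; case: pselect. Qed.

Lemma swapR : swap y = x.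
Proof. by rewrite /swap; do 2?case: pselect => //. Qed.

Lemma swap_id t : t <> x -> t <> y -> swap t = t.
Proof. by rewrite /swap; do 2?case: pselect => //. Qed.

Lemma swapK : involutive swap.
Proof.
move=> t; have [->|tx] := pselect (t = x); first by rewrite swapL swapR.
have [->|ty] := pselect (t = y); first by rewrite swapR swapL.
by rewrite !swap_id // swap_id.
Qed.

Definition Sym_swap : Sym T := exist _ swap (Bijective swapK swapK).

End Transposition.

(** If [f] moves [x], transpose [f x] with a third point: this fixes [x] but moves [f x], so it does
    not commute with [f]. *)
Lemma Sym_center_trivial (T : Type) (f : T -> T) : has_third T ->
  (forall s : Sym T, f \o sval s =1 sval s \o f) -> f =1 id.
Proof.
move=> T3 fC x; apply: contrapT => fx.
have [z [zx zfx]] := T3 x (f x); have := fC (Sym_swap (f x) z) x.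
rewrite /= swap_id ?swapL //; last by move/esym.
- by move/esym.
- by move=> /esym.
Qed.

(** A right translation with a fixed point is the identity, whereas transposing [x] and [1] fixes a
    third point and moves [x]. Hence every successor stage is strictly larger than the image of the
    previous one. *)
Lemma nonregular_perm (G : groupType) : has_third G ->
  exists s : Sym G, forall g : G, s <> right_regular g.
Proof.
move=> G3; have [x [x1 _]] := G3 1 1; have [z [zx z1]] := G3 x 1.
exists (Sym_swap x 1) => g E.
have : sval (Sym_swap x 1) z = z * g by rewrite E.
rewrite /= swap_id // => /esym/eqP;
  rewrite -{2}[z]mulg1 (can_eq (mulKg z)) => /eqP g1.
have : sval (Sym_swap x 1) x = x * g by rewrite E.
by rewrite /= swapL g1 mulg1 => /esym.
Qed.

Lemma emb_Sym_set (T : Type) : emb nat T -> emb (Sym T) (set T).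
Proof.
move=> nT; apply: emb_trans (emb_set (emb_square nT)).
exists (fun s : Sym T => [set p | p.2 = sval s p.1]) => s t E.
apply: Sym_inj => x.
have : [set p | p.2 = sval s p.1] (x, sval s x) by [].
by rewrite E.
Qed.

(** View [T] as [T * bool] and let a subset [A] act by flipping the bit above its points. *)
Lemma emb_set_Sym (T : Type) : emb nat T -> emb (set T) (Sym T).
Proof.
move=> nT.
have TB : emb T (T * bool) by exists (fun x => (x, true)) => x y [].
have BT : emb (T * bool) T.
  apply: emb_prod_le (emb_refl _) _ => //; exact: emb_trans emb_bool_nat nT.
have [h [k hK kK]] := emb_bij TB BT.
pose fl (A : set T) (p : T * bool) := (p.1, p.2 (+) `[< A p.1 >]).
have flK A : involutive (fl A) by move=> [x b]; rewrite /fl /= addbK.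
have bij A : bijective (k \o fl A \o h).
  exact: bij_comp (bij_comp (Bijective kK hK) (Bijective (flK A) (flK A)))
    (Bijective hK kK).
exists (fun A => exist _ _ (bij A)) => A B E.
apply/funext => x; apply/propext.
have := congr1 (fun s => sval s (k (x, false))) E.
rewrite /= kK => /(can_inj kK); rewrite /fl /= => -[{}E].
by split=> /asboolP AB; apply/asboolP; rewrite ?E // -E.
Qed.

(** * Direct limits of groups *)

Definition to_multiplicative (G H : groupType) (f : G -> H)
    (fM : {morph f : x y / x * y}) : {multiplicative G -> H} :=
  HB.pack_for {multiplicative G -> H} f (isMultiplicative.Build G H f fM).

(** Subgroups as groups in their own right, to serve as targets of the universal property in
    [direct_limit_surj]. *)
Record subgroup (G : groupType) := Subgroup {
  subgroup_set :> G -> Prop;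
  subgroup1 : subgroup_set 1;
  subgroupM : forall x y,
    subgroup_set x -> subgroup_set y -> subgroup_set (x * y);
  subgroupV : forall x, subgroup_set x -> subgroup_set x^-1 }.

Definition subgroup_type G (H : subgroup G) := {x : G | H x}.

Section SubgroupType.
Variables (G : groupType) (H : subgroup G).
Implicit Types x y z : subgroup_type H.

HB.instance Definition _ := gen_eqMixin (subgroup_type H).
HB.instance Definition _ := gen_choiceMixin (subgroup_type H).

Definition subgroup_mul x y : subgroup_type H :=
  exist _ (sval x * sval y) (subgroupM (svalP x) (svalP y)).
Definition subgroup_one : subgroup_type H := exist _ 1 (subgroup1 H).
Definition subgroup_inv x : subgroup_type H :=
  exist _ (sval x)^-1 (subgroupV (svalP x)).

Fact subgroup_mulA : associative subgroup_mul.
Proof. by move=> x y z; apply: sval_inj; apply: mulgA. Qed.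
Fact subgroup_mul1 : left_id subgroup_one subgroup_mul.
Proof. by move=> x; apply: sval_inj; apply: mul1g. Qed.
Fact subgroup_mulr1 : right_id subgroup_one subgroup_mul.
Proof. by move=> x; apply: sval_inj; apply: mulg1. Qed.
Fact subgroup_mulV : left_inverse subgroup_one subgroup_inv subgroup_mul.
Proof. by move=> x; apply: sval_inj; apply: mulVg. Qed.
Fact subgroup_mulrV : right_inverse subgroup_one subgroup_inv subgroup_mul.
Proof. by move=> x; apply: sval_inj; apply: mulgV. Qed.

HB.instance Definition _ := isGroup.Build (subgroup_type H)
  subgroup_mulA subgroup_mul1 subgroup_mulr1 subgroup_mulV subgroup_mulrV.

End SubgroupType.

Lemma multiplicative1 (G H : groupType) (f : {multiplicative G -> H}) : f 1 = 1.
Proof.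
by apply: (mulgI (f 1)); rewrite -gmulfM !mulg1.
Qed.

Lemma multiplicativeV (G H : groupType) (f : {multiplicative G -> H}) x :
  f x^-1 = (f x)^-1.
Proof.
by apply: (mulgI (f x)); rewrite -gmulfM !mulgV multiplicative1.
Qed.

(** * Reduced products of the stages *)

Section Germ.
Variables (I : wordinal) (S : I -> groupType) (D : set I).
Hypothesis D0 : D !=set0.

Definition eventually_eq (f g : forall a, S a) : Prop :=
  exists2 a, D a & forall b, D b -> wle a b -> f b = g b.

Let max_in a b : D a -> D b -> exists c, [/\ D c, wle a c & wle b c].
Proof.
move=> Da Db; have [ab|ba] := orP (wle_total a b).
  by exists b; split=> //; apply: wle_refl.
by exists a; split=> //; apply: wle_refl.
Qed.

Let ee_pw (f g : forall a, S a) : (forall a, f a = g a) -> eventually_eq f g.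
Proof. by case: D0 => a Da fg; exists a. Qed.

Let ee_sym f g : eventually_eq f g -> eventually_eq g f.
Proof. by move=> [a Da fg]; exists a => // b Db /fg->. Qed.

Let ee_trans g f h :
  eventually_eq f g -> eventually_eq g h -> eventually_eq f h.
Proof.
move=> [a Da fg] [b Db gh]; have [c [Dc ac bc]] := max_in Da Db.
exists c => // d Dd cd; rewrite fg //; last exact: wle_trans cd.
by rewrite gh //; exact: wle_trans cd.
Qed.

Let ee_mul f f' g g' : eventually_eq f f' -> eventually_eq g g' ->
  eventually_eq (fun a => f a * g a) (fun a => f' a * g' a).
Proof.
move=> [a Da ff] [b Db gg]; have [c [Dc ac bc]] := max_in Da Db.
exists c => // d Dd cd; rewrite ff //; last exact: wle_trans cd.
by rewrite gg //; exact: wle_trans cd.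
Qed.

(** The quotient of the product of all [S a] by eventual equality along [D]. The dummy [let] keeps
    [D0] in the type, since the group laws rely on [D] being nonempty. *)
Definition germ := let _ := D0 in
  {C : set (forall a, S a) | exists f, C = eventually_eq f}.

Definition germ_of f : germ := exist _ (eventually_eq f) (ex_intro _ f erefl).

Definition germ_repr (C : germ) : forall a, S a := sval (cid (svalP C)).

Lemma germ_reprK C : germ_of (germ_repr C) = C.
Proof. by apply: sval_inj; rewrite /= -(svalP (cid (svalP C))). Qed.

Lemma germ_ofP f g : germ_of f = germ_of g <-> eventually_eq f g.
Proof.
split=> [/(congr1 sval) /= -> |fg]; first exact: ee_pw.
apply: sval_inj; apply/seteqP; split=> h /=; last exact: ee_trans.
by apply: ee_trans; apply: ee_sym.
Qed.

Let repr_of f : eventually_eq (germ_repr (germ_of f)) f.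
Proof. by apply/germ_ofP; rewrite germ_reprK. Qed.

HB.instance Definition _ := gen_eqMixin germ.
HB.instance Definition _ := gen_choiceMixin germ.

Definition germ_mul (C E : germ) : germ :=
  germ_of (fun a => germ_repr C a * germ_repr E a).
Definition germ_one : germ := germ_of (fun=> 1).
Definition germ_inv (C : germ) : germ := germ_of (fun a => (germ_repr C a)^-1).

Lemma germ_ofM f g :
  germ_mul (germ_of f) (germ_of g) = germ_of (fun a => f a * g a).
Proof. by apply/germ_ofP; apply: ee_mul (repr_of f) (repr_of g). Qed.

Fact germ_mulA : associative germ_mul.
Proof.
move=> x y z; rewrite -(germ_reprK x) -(germ_reprK y) -(germ_reprK z) !germ_ofM.
by apply/germ_ofP/ee_pw => a; apply: mulgA.
Qed.
Fact germ_mul1 : left_id germ_one germ_mul.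
Proof.
move=> x; rewrite -(germ_reprK x) germ_ofM.
by apply/germ_ofP/ee_pw => a; apply: mul1g.
Qed.
Fact germ_mulr1 : right_id germ_one germ_mul.
Proof.
move=> x; rewrite -(germ_reprK x) germ_ofM.
by apply/germ_ofP/ee_pw => a; apply: mulg1.
Qed.
Fact germ_mulV : left_inverse germ_one germ_inv germ_mul.
Proof.
move=> x; rewrite -{2}(germ_reprK x) germ_ofM.
by apply/germ_ofP/ee_pw => a; apply: mulVg.
Qed.
Fact germ_mulrV : right_inverse germ_one germ_inv germ_mul.
Proof.
move=> x; rewrite -{1}(germ_reprK x) germ_ofM.
by apply/germ_ofP/ee_pw => a; apply: mulgV.
Qed.

HB.instance Definition _ := isGroup.Build germ
  germ_mulA germ_mul1 germ_mulr1 germ_mulV germ_mulrV.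

End Germ.

Section DirectLimit.
Variables (I : wordinal) (S : directed_system I) (D : set I) (L : groupType).
Variable g : forall a, D a -> {multiplicative S a -> L}.
Hypothesis D0 : D !=set0.
Hypothesis gL : is_direct_limit g.

Lemma dmap_irr a b (p q : wle a b) x : dmap S p x = dmap S q x.
Proof. by rewrite (bool_irrelevance p q). Qed.

(** The images of the stages form a subgroup, by directedness. The cocone factors through it, and
    the induced map followed by the inclusion is the identity by uniqueness. *)
Lemma direct_limit_surj y : exists a (Da : D a) x, g Da x = y.
Proof.
pose P (y : L) := exists a (Da : D a) x, g Da x = y.
have P1 : P 1.
  by case: D0 => a Da; exists a, Da, 1; rewrite multiplicative1.
have PM y1 y2 : P y1 -> P y2 -> P (y1 * y2).
  move=> [a [Da [x <-]]] [b [Db [z <-]]].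
  have [ab|ba] := orP (wle_total a b).
    by exists b, Db, (dmap S ab x * z); rewrite gmulfM (gL.1 _ _ Da Db ab).
  by exists a, Da, (x * dmap S ba z); rewrite gmulfM (gL.1 _ _ Db Da ba).
have PV y1 : P y1 -> P y1^-1.
  by move=> [a [Da [x <-]]]; exists a, Da, x^-1; rewrite multiplicativeV.
pose H := Subgroup P1 PM PV.
have Pg a (Da : D a) x : H (g Da x) by exists a, Da, x.
have hM a (Da : D a) : {morph (fun x => exist _ _ (Pg a Da x) :
  subgroup_type H) : x y / x * y}.
  by move=> x z; apply: sval_inj; rewrite /= gmulfM.
pose h a (Da : D a) := to_multiplicative (hM a Da).
have hC : is_cocone h.
  move=> a b Da Db ab x; apply: sval_inj; exact: (gL.1 a b Da Db ab x).
have [[u uP] _] := gL.2 _ _ hC.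
have vM : {morph (fun y => sval (u y)) : x y / x * y}.
  by move=> x z; rewrite gmulfM.
have iM : {morph (fun y : L => y) : x y / x * y} by [].
have [_ U] := gL.2 _ _ gL.1.
have <- : sval (u y) = y.
  apply: (U (to_multiplicative vM) (to_multiplicative iM)) => // a Da x /=.
  by rewrite uP.
exact: (svalP (u y)).
Qed.

(** Send [x] to the germ of its transports to later stages. This cocone factors through [L], so
    elements identified in [L] have equal transports from some stage on, and the transports are
    injective. *)
Lemma direct_limit_inj a (Da : D a) :
  (forall b (ab : wle a b), D b -> injective (dmap S ab)) -> injective (g Da).
Proof.
move=> ainj.
(* Where [a <= b] fails, [1] is a default. *)
pose h0 a (Da : D a) x : germ S D0 := germ_of D0 (fun b : I =>
  match pselect (wle a b) with left ab => dmap S ab x | right _ => 1 end).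
have hM b (Db : D b) : {morph h0 b Db : x y / x * y}.
  move=> x y; rewrite [RHS]germ_ofM; apply/germ_ofP; exists b => // c Dc bc.
  by case: pselect => // bc'; rewrite gmulfM.
have hC : is_cocone (fun a Da => to_multiplicative (hM a Da)).
  move=> b c Db Dc bc x; apply/germ_ofP; exists c => // d Dd cd.
  case: pselect => // cd'; case: pselect => [bd|[]]; last exact: wle_trans cd.
  by rewrite dmap_comp.
have [[u uP] _] := gL.2 _ _ hC.
move=> x y /(congr1 u); rewrite !uP /= => /germ_ofP[b Db bxy].
(* If the threshold [b] comes before [a], the comparison is made at stage [a] itself. *)
have [ab|ba] := orP (wle_total a b).
  have := bxy _ Db (wle_refl b); case: pselect => // ab'; exact: ainj.
have := bxy _ Da ba; case: pselect => [aa|[]]; last exact: wle_refl.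
exact: ainj.
Qed.

End DirectLimit.

(** * Uncountable initial ordinals *)

Section UncountableCardinal.
Variable kappa : wordinal.
Hypothesis hkappa : uncountable_cardinal kappa.

Lemma initial_no_emb (a : kappa) : ~ emb kappa (seg a).
Proof.
move=> [f fi]; apply: (hkappa.1 a); apply: Cantor_Bernstein;
  last exact: subset_card_le.
suff /injfunPex[h] : exists2 g : kappa -> kappa,
    set_fun setT [set b | wlt b a] g & set_inj setT g.
  exact: inj_card_le h.
exists (sval \o f) => [x _|x y _ _ /sval_inj /fi//]; exact: (svalP (f x)).
Qed.

(** The other alternative of [seg_emb_or] would make [kappa] countable. *)
Lemma infinite_seg : exists a : kappa, emb nat (seg a).
Proof.
have [/emb_cardP|//] := seg_emb_or kappa nat.
by case: hkappa.
Qed.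

(** Otherwise [kappa] is covered by [seg a] and an image of [seg b], hence embeds in the segment of
    the larger of the two, which is infinite and absorbs the sum. *)
Lemma no_union_of_segs (a b : kappa) (h : seg b -> kappa) :
  emb nat (seg a) -> exists y, wle a y /\ forall x, h x <> y.
Proof.
move=> nata; apply: contrapT => H.
have cover y : wlt y a \/ exists x, h x = y.
  have [ay|] := wle_lt_dec a y; last by left.
  by right; apply: contrapT => n; apply: H; exists y; split=> // x E; apply: n;
    exists x.
have kab : emb kappa (seg a + seg b).
  apply: (@surj_emb _ _ (fun s => match s with inl x => sval x | inr x =>
    h x end)).
  by move=> y; have [ya|[x <-]] := cover y;
    [exists (inl (exist _ y ya))|exists (inr x)].
have [c [ac bc]] : exists c, wle a c /\ wle b c.
  by have [ab|ba] := orP (wle_total a b); [exists b|exists a]; split=> //;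
    exact: wle_refl.
apply: (@initial_no_emb c); apply: (emb_trans kab).
apply: emb_sum_le;
  [exact: emb_trans (emb_seg ac)|exact: emb_seg|exact: emb_seg].
Qed.

(** If [a] were the last element, [kappa] would be the infinite [seg a] plus one point, hence embed
    in [seg a]. *)
Lemma cardinal_succ (a : kappa) : exists b, is_succ a b.
Proof.
have [a0 nata0] := infinite_seg.
suff [b ab] : exists b, wlt a b by exact: succ_exists ab.
apply: contrapT => n.
have amax b : wle b a by apply/wleNgt => ab; apply: n; exists b.
apply: (@initial_no_emb a); apply: (@emb_trans (seg a + unit)).
  apply: (@surj_emb _ _ (fun s : seg a + unit =>
    match s with inl x => sval x | inr _ => a end)) => b.
  have [ba|ab] := pselect (wlt b a); first by exists (inl (exist _ b ba)).
  by exists (inr tt); have [->|//] := wle_eqVlt (amax b).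
have natS := emb_trans nata0 (emb_seg (amax a0)).
apply: emb_sum_le (emb_refl _) _ => //; have [f fi] := natS.
by exists (fun=> f 0%N) => -[] [].
Qed.

Lemma shift_exists (a0 : kappa) : emb nat (seg a0) ->
  exists f : kappa -> kappa, (forall b, wle a0 (f b)) /\
    (forall a b, wlt a b -> wlt (f a) (f b)).
Proof.
move=> nata0; apply: (@greedy kappa kappa (fun b => wle a0 b)) => b h.
exact: (no_union_of_segs h nata0).
Qed.

End UncountableCardinal.

(** * Stages of a regular representation system *)

Section RegularRepSystem.
Variables (kappa : wordinal) (G0 : groupType) (S : directed_system kappa).
Hypothesis hS : regular_rep_system G0 S.
Hypothesis G03 : has_third G0.
Implicit Types a b c : kappa.

Lemma right_regular_inj (G : groupType) : injective (@right_regular G).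
Proof.
by move=> x y /(congr1 (fun s => sval s 1)) /=; rewrite !mul1g.
Qed.

Lemma limit_dmap_surj c (y : S c) : is_limit c ->
  exists a (ac : wlt a c) x, dmap S (proj1 ac) x = y.
Proof.
move=> lc.
exact: direct_limit_surj (is_limit_gt lc) (rrs_limit hS lc) y.
Qed.

(** Induction on the target: a successor step adds a regular representation, and a limit step only
    needs the maps between earlier stages. *)
Lemma dmap_inj a b (ab : wle a b) : injective (dmap S ab).
Proof.
elim/(well_founded_ind (@wlt_wf kappa)): b a ab => b IH a ab.
have [E|lab] := wle_eqVlt ab.
  by subst b => x y; rewrite !dmap_id.
have [zb|[b' b'b]|lb] := wzero_succ_limit b.
- by case/wltNge: lab.
- have ab' := is_succ_le b'b lab; have le := b'b.1.1.
  have [e _ eP] := rrs_succ hS le b'b.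
  move=> x y; rewrite -!(dmap_comp ab' le) => /(congr1 e).
  by rewrite !eP => /right_regular_inj; apply: IH; case: b'b.
- have := @direct_limit_inj _ _ _ _ _ (is_limit_gt lb) (rrs_limit hS lb) a lab.
  move=> inj x y; rewrite (dmap_irr ab (proj1 lab)) (dmap_irr ab (proj1 lab)).
  by apply: inj => c ac cb; apply: IH.
Qed.

Lemma emb_dmap a b : wle a b -> emb (S a) (S b).
Proof. by move=> ab; exists (dmap S ab); apply: dmap_inj. Qed.

Lemma stage_has_third a : has_third (S a).
Proof.
have [|z [_ zm]] := @wo_min kappa setT; first by exists a.
have z0 : is_zero z by move=> b; apply: zm.
have [phi [phi' _ phiK]] := rrs_zero hS z0.
have e : emb G0 (S a).
  by apply: (@emb_trans (S z)); [exists phi';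
    exact: can_inj phiK|exact: emb_dmap].
by apply: (emb_has_third e) => //; exists; exact: 1.
Qed.

Lemma stage_succ_new a b (ab : wle a b) : is_succ a b ->
  exists y, forall x, dmap S ab x <> y.
Proof.
move=> sab; have [e [e' eK e'K] eP] := rrs_succ hS ab sab.
have [s sn] := nonregular_perm (@stage_has_third a).
by exists (e' s) => x E; apply: (sn x); rewrite -eP E e'K.
Qed.

Lemma emb_set_succ a b : emb nat (S a) -> is_succ a b -> emb (set (S a)) (S b).
Proof.
move=> nS sab; have [e [e' _ e'K] _] := rrs_succ hS sab.1.1 sab.
by apply: (emb_trans (emb_set_Sym nS)); exists e'; apply: can_inj e'K.
Qed.

(* [a] is sent to an element which first appears at stage [a + 1]; such
   elements are distinct for distinct [a]. *)
Lemma emb_stages (D : set kappa) (T : Type) (g : forall a, D a -> S a -> T) :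
  (forall a Da, injective (g a Da)) ->
  (forall a b Da Db (ab : wle a b) x, g b Db (dmap S ab x) = g a Da x) ->
  emb {a | exists2 b, is_succ a b & D b} T.
Proof.
move=> ginj gC.
have new (s : {a | exists2 b, is_succ a b & D b}) : exists t, exists b (Db :
  D b)
    (ab : wle (sval s) b) y, [/\ is_succ (sval s) b,
    forall x, dmap S ab x <> y & t = g b Db y].
  case: s => a [b sab Db] /=; have [y ny] := stage_succ_new sab.1.1 sab.
  by exists (g b Db y), b, Db, sab.1.1, y.
case/choice: new => t tP; exists t.
(* If [s] precedes [s'], the element chosen for [s] exists by stage [s'], so it cannot be new right
   after [s']. *)
have lt s s' : t s = t s' -> ~ wlt (sval s) (sval s').
  move=> tss' ss'; have [b [Db [ab [y [sab _ ts]]]]] := tP s.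
  have [b' [Db' [ab' [y' [sab' ny' ts']]]]] := tP s'.
  have bs' : wle b (sval s') by apply: sab.2.
  have bb' : wle b b' by exact: (wle_trans bs' ab').
  apply: (ny' (dmap S bs' y)); apply: (ginj _ Db').
  by rewrite (dmap_comp _ _ bb') (gC _ _ Db) -ts -ts'.
move=> s s' E; apply: sval_inj.
by apply: wle_anti; apply/wleNgt; apply: lt.
Qed.

(** Each [a] below [b] contributes an element new at its successor, which is at most [b]. *)
Lemma emb_seg_stage b : emb (seg b) (S b).
Proof.
apply: (@emb_trans {a | exists2 c, is_succ a c & wle c b}); last first.
  apply: (@emb_stages (fun a => wle a b) (S b) (fun a ab => dmap S ab)).
    by move=> a ab; apply: dmap_inj.
  by move=> a c ab cb ac x; apply: dmap_comp.
have H a : wlt a b -> exists2 c, is_succ a c & wle c b.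
  by move=> ab; have [c ac] := succ_exists ab; exists c => //; apply: ac.2.
pose f (x : seg b) := exist (fun a => exists2 c, is_succ a c & wle c b)
  (sval x) (H _ (proj2_sig x)).
by exists f => x y [] /sval_inj.
Qed.

End RegularRepSystem.

(** * Cardinalities of the stages and of the limit *)

Section StageCardinals.
Variables (kappa : wordinal) (G0 G : groupType) (S : directed_system kappa).
Variable g : forall a : kappa, [set: kappa] a -> {multiplicative S a -> G}.
Hypothesis hkappa : uncountable_cardinal kappa.
Hypothesis hS : regular_rep_system G0 S.
Hypothesis G03 : has_third G0.
Hypothesis cG0 : countable [set: G0].
Hypothesis gG : is_direct_limit g.
Implicit Types a b c : kappa.

Lemma kappa_nonempty : [set: kappa] !=set0.
Proof. by have [a _] := infinite_seg hkappa; exists a. Qed.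

Lemma colimit_surj y : exists a (x : S a), g (a := a) I x = y.
Proof.
have [a [[] [x <-]]] := direct_limit_surj kappa_nonempty gG y.
by exists a, x.
Qed.

Lemma colimit_inj a : injective (g (a := a) I).
Proof.
by apply: (direct_limit_inj kappa_nonempty gG) => b ab _;
  apply: dmap_inj hS _ _ _.
Qed.

Lemma colimit_dmap a b (ab : wle a b) x : g (a := b) I (dmap S ab x) = g (a :=
  a) I x.
Proof. exact: gG.1. Qed.

(* The ordinals [<= kappa.+1]; those below [kappa] are the [Some (Some a)], and
   [kappa] itself is [Some None]. *)
Let O : wordinal := osucc (osucc kappa).
Let i a : O := Some (Some a).

Let ilt a b : wlt (i a) (i b) <-> wlt a b.
Proof.
split=> [[ab nab]|[ab nab]]; split=> //; first by move=> E; apply: nab;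
  rewrite E.
by move=> [].
Qed.

Let ilt_top a : wlt (i a) (Some None : O).
Proof. by []. Qed.

Let below_i (x : O) b : wlt x (i b) -> exists2 a, x = i a & wlt a b.
Proof. by case: x => [[a|]|] [] // ab nab; exists a => //; apply/ilt. Qed.

Let below_top (x : O) : wlt x (Some None) -> exists a, x = i a.
Proof. by case: x => [[a|]|] [] // ab nab; exists a. Qed.

(** A union of stages is a quotient of their disjoint sum, whose index set and summands embed in
    [beth c]. Used for limit stages and for [G]. *)
Let emb_colimit_beth (X : Type) (c : O) (D : set kappa)
    (h : forall a, D a -> S a -> X) :
  (forall y, exists a (Da : D a) x, h a Da x = y) ->
  (forall a, D a -> wlt (i a) c /\ emb (S a) (beth (i a))) -> emb X (beth c).
Proof.
move=> hs HD; apply: (@emb_trans {a : {a | D a} & S (sval a)}).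
  apply: (@surj_emb _ _ (fun s =>
    h (sval (tag s)) (proj2_sig (tag s)) (tagged s))).
  move=> y; have [a [Da [x E]]] := hs y.
  by exists (existT (fun a : {a | D a} => S (sval a)) (exist _ a Da) x).
apply: emb_sigT_le; first exact: emb_nat_beth.
  apply: emb_trans (emb_seg_beth c).
  exists (fun a : {a | D a} => exist (fun x =>
    wlt x c) (i (sval a)) (HD _ (proj2_sig a)).1).
  by move=> a b []; apply: sval_inj.
by move=> [a Da] /=; have [ac e] := HD a Da; apply: (emb_trans e);
  apply: emb_beth; case: ac.
Qed.

Lemma emb_stage_beth a : emb (S a) (beth (i a)).
Proof.
elim/(well_founded_ind (@wlt_wf kappa)): a => b IH.
have [zb|[a sab]|lb] := wzero_succ_limit b.
- have [phi [phi' phiK _]] := rrs_zero hS zb.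
  apply: (@emb_trans G0); first by exists phi; apply: can_inj phiK.
  apply: (@emb_trans nat); last exact: emb_nat_beth.
  exact/emb_cardP.
- have [e [e' eK _] _] := rrs_succ hS sab.1.1 sab.
  have natB := emb_nat_beth (i a).
  apply: (@emb_trans (set (beth (i a)))); last by apply: emb_set_beth;
    apply/ilt; case: sab.
  (* A permutation of [S a] is coded by its graph, carried into the square of [beth (i a)] along an
     injection [f]; [S a] may be finite here. *)
  apply: emb_trans (emb_set (emb_square natB)).
  have [f fi] := IH a sab.1.
  exists (fun y => [set p | exists2 x, p.1 = f x & p.2 = f (sval (e y) x)]).
  move=> y y' E; apply: (can_inj eK); apply: Sym_inj => x.
  have : [set p | exists2 x, p.1 = f x & p.2 = f (sval (e y) x)] (f x,
    f (sval (e y) x)).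
    by exists x.
  by rewrite E => -[x' /= /fi <- /fi].
- apply: (@emb_colimit_beth _ (i b) (fun a => wlt a b) (fun a ab x =>
    dmap S (proj1 ab) x)).
    by move=> y; apply: limit_dmap_surj hS _ _ _.
  by move=> a ab; split; [apply/ilt|apply: IH].
Qed.

Lemma emb_colimit_beth_top : emb G (beth (Some None : O)).
Proof.
apply: (@emb_colimit_beth _ (Some None : O) setT (fun a Da x => g Da x)).
  by move=> y; have [a [x E]] := colimit_surj y; exists a, I, x.
by move=> a _; split; [exact: ilt_top|exact: emb_stage_beth].
Qed.

Lemma infinite_stage :
  exists a0, emb nat (seg a0) /\ forall a, wle a0 a -> emb nat (S a).
Proof.
have [a0 na0] := infinite_seg hkappa; exists a0; split=> // a a0a.
apply: (emb_trans na0); apply: (emb_trans (emb_seg_stage hS G03 a0)).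
exact: (emb_dmap hS a0a).
Qed.

Let emb_seg_i a : emb (seg (i a)) (seg a).
Proof.
have H (b : seg a) : wlt (i (sval b)) (i a) by apply/ilt; case: b.
apply: (@surj_emb _ _ (fun b : seg a => exist (fun x :
  O => wlt x (i a)) (i (sval b)) (H b) : seg (i a))).
move=> [x xa]; have [b E ba] := below_i xa; exists (exist _ b ba).
by apply: sval_inj; exact: esym E.
Qed.

Lemma emb_beth_colimit_top : emb (beth (Some None : O)) G.
Proof.
have [a0 [na0 nS]] := infinite_stage.
have [f [f0 fm]] := shift_exists hkappa na0.
have natG : emb nat G.
  by apply: (emb_trans (nS _ (wle_refl a0))); exists (g (a := a0) I);
    exact: colimit_inj.
(* One more symmetric group absorbs one more power set. *)
have step a b : emb (beth (i a)) (S (f a)) -> is_succ (f a) b -> emb (set (beth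
  (i a))) (S b).
  move=> Ba sb; apply: (emb_trans (emb_set Ba)); apply: (emb_set_succ hS _ sb);
    exact: nS.
have low a : emb (beth (i a)) (S (f a)).
  elim/(well_founded_ind (@wlt_wf kappa)): a => b IH.
  apply: beth_emb_min; first exact: nS.
    apply: (emb_trans (emb_seg_i b));
      apply: emb_trans (emb_seg_stage hS G03 (f b)).
    exists (fun x : seg b => exist (fun y =>
      wlt y (f b)) (f (sval x)) (fm _ _ (proj2_sig x))).
    by move=> x y [] /(strict_mono_inj fm) /sval_inj.
  (* The successor [c] of [f a] is at most [f b], as [f] is strictly increasing. *)
  move=> x /below_i[a -> ab]; have [c sc] := cardinal_succ hkappa (f a).
  apply: (emb_trans (step _ _ (IH _ ab) sc)); apply: (emb_dmap hS).
  by apply: sc.2; apply: fm.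
apply: beth_emb_min => //.
  apply: (@emb_trans kappa).
    apply: (@surj_emb _ _ (fun a : kappa => exist (fun x :
      O => wlt x (Some None)) (i a) (ilt_top a))).
    by move=> [x xt]; have [a E] := below_top xt; exists a; apply: sval_inj;
      exact: esym E.
  (* [kappa] embeds in [G] through the elements new at successor stages. *)
  apply: emb_trans (@emb_stages _ _ _ hS G03 setT G (fun a Da x => g Da x) _ _).
  - have H a : exists2 b, is_succ a b & [set: kappa] b.
      by have [b] := cardinal_succ hkappa a; exists b.
    by exists (fun a => exist _ a (H a)) => a b [].
  - by move=> a []; apply: colimit_inj.
  - by move=> a b [] [] ab x; apply: colimit_dmap.
move=> x /below_top[a ->]; have [c sc] := cardinal_succ hkappa (f a).
apply: (emb_trans (step _ _ (low a) sc)).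
by exists (g (a := c) I); apply: colimit_inj.
Qed.

End StageCardinals.

(** * Automorphisms *)

Lemma inj_surj_bij (T U : Type) (f : T -> U) :
  injective f -> (forall y, exists x, f x = y) -> bijective f.
Proof. by move=> fi /choice[h hK]; exists h => // x; apply: fi. Qed.

Lemma bij_surj (T U : Type) (f : T -> U) :
  bijective f -> forall y, exists x, f x = y.
Proof. by move=> [h _ hK] y; exists (h y). Qed.

(** The universal property turns a compatible family into an endomorphism; its bijectivity is
    checked on stages, two elements being first moved to a common one. *)
Lemma direct_limit_aut (I : wordinal) (S : directed_system I) (D : set I)
    (L : groupType) (g : forall a, D a -> {multiplicative S a -> L})
    (phi : forall a, S a -> S a) :
  D !=set0 -> is_direct_limit g ->
  (forall a (Da : D a), injective (g a Da)) ->
  (forall a, D a -> AutG (S a) (phi a)) ->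
  (forall a b (ab : wle a b) x, D a -> D b ->
     phi b (dmap S ab x) = dmap S ab (phi a x)) ->
  exists2 F, AutG L F & forall a (Da : D a) x, F (g a Da x) = g a Da (phi a x).
Proof.
move=> D0 gL ginj phiA phiC.
have hM a (Da : D a) : {morph (fun x => g a Da (phi a x)) : x y / x * y}.
  by move=> x y; rewrite (phiA a Da).2 gmulfM.
have hC : is_cocone (fun a Da => to_multiplicative (hM a Da)).
  by move=> a b Da Db ab x; rewrite /= phiC // (gL.1 _ _ Da).
have [[u uP] _] := gL.2 _ _ hC.
have surj := direct_limit_surj D0 gL.
exists u => //; split; last exact: gmulfM.
apply: inj_surj_bij => [y y'|y].
  wlog [a [b [Da [Db [x [x' [ab -> ->]]]]]]] : y y' / exists a b (Da :
    D a) (Db : D b) x x',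
      [/\ wle a b, y = g a Da x & y' = g b Db x'].
    move=> W; have [a [Da [x yE]]] := surj y; have [b [Db [x' y'E]]] := surj y'.
    have [ab|ba] := orP (wle_total a b); first by apply: W;
      exists a, b, Da, Db, x, x'.
    by move=> E; apply/esym/W => //; exists b, a, Db, Da, x', x.
  rewrite -(gL.1 _ _ Da Db ab) !uP => /ginj.
  have [[inv phiK _] _] := phiA b Db.
  by move=> /(can_inj phiK) ->.
have [a [Da [x <-]]] := surj y; have [x' <-] := bij_surj (phiA a Da).1 x.
by exists (g a Da x'); rewrite uP.
Qed.

Section Automorphisms.
Variables (kappa : wordinal) (G0 : groupType) (S : directed_system kappa).
Hypothesis hS : regular_rep_system G0 S.
Implicit Types a b c : kappa.

(** The isomorphism is chosen once, so that all twisting conditions refer to the same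
    identification. *)
Definition stage_iso a b (sab : is_succ a b) :
  {multiplicative S b -> Sym (S a)} :=
  s2val (cid2 (rrs_succ hS sab.1.1 sab)).

Lemma stage_iso_bij a b (sab : is_succ a b) : bijective (stage_iso sab).
Proof. exact: (s2valP (cid2 (rrs_succ hS sab.1.1 sab))). Qed.

Lemma stage_iso_dmap a b (sab : is_succ a b) (ab : wle a b) x :
  stage_iso sab (dmap S ab x) = right_regular x.
Proof.
rewrite (dmap_irr ab sab.1.1);
  exact: (s2valP' (cid2 (rrs_succ hS sab.1.1 sab))).
Qed.

Variable t : forall a, S a.

(* [F] extends the automorphisms [phi a], [a < b], to stage [b]; when [b] is
   the successor of [a], it is the conjugation by [x |-> phi a (t a * x)], which
   restricts to [phi a] because left translations centralize right ones. *)
Definition twisted_extension (phi : forall a, S a -> S a) b (F : S b -> S b) :=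
  [/\ AutG (S b) F,
      forall a (ab : wle a b) x,
        wlt a b -> F (dmap S ab x) = dmap S ab (phi a x) &
      forall a (sab : is_succ a b) y x,
        sval (stage_iso sab (F y)) (phi a (t a * x)) =
        phi a (t a * sval (stage_iso sab y) x)].

Lemma twisted_extension_exists (phi : forall a, S a -> S a) b :
  (forall a, wlt a b -> AutG (S a) (phi a)) ->
  (forall a a' (aa : wle a a') x, wlt a' b ->
     phi a' (dmap S aa x) = dmap S aa (phi a x)) ->
  exists F : S b -> S b, twisted_extension phi F.
Proof.
move=> phiA phiC; have [zb|[a sab]|lb] := wzero_succ_limit b.
- exists id; split=> [|a ab x lab|a sab].
  + by split=> //; exists id.
  + by have /wltNge[] := lab.
  + by have /wltNge[] := sab.1.
- have [e' eK e'K] := stage_iso_bij sab; set e := stage_iso sab in eK e'K.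
  have [phib phiM] := phiA a sab.1; have [phi' phiK phi'K] := phib.
  pose f x := phi a (t a * x); pose h x := (t a)^-1 * phi' x.
  have fK : cancel f h by move=> x; rewrite /f /h phiK mulKg.
  have hK : cancel h f by move=> x; rewrite /f /h mulVKg phi'K.
  pose conj (s : Sym (S a)) : Sym (S a) := exist _ (f \o sval s \o h)
    (bij_comp (bij_comp (Bijective fK hK) (svalP s)) (Bijective hK fK)).
  have conjM : {morph conj : s s' / s * s'}.
    by move=> s s'; apply: Sym_inj => x; rewrite /= fK.
  pose F y := e' (conj (e y)).
  have eF y : e (F y) = conj (e y) by rewrite /F e'K.
  (* Conjugating right multiplication by [x] gives right multiplication by [phi a x]: the factor
     [t a] cancels. *)
  have Fdmap (ab : wle a b) x : F (dmap S ab x) = dmap S ab (phi a x).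
    apply: (can_inj eK); rewrite eF /e !stage_iso_dmap; apply: Sym_inj => z /=.
    by rewrite /f /h mulgA phiM mulVKg phi'K.
  exists F; split.
  + split; last by move=> y z; apply: (can_inj eK);
      rewrite gmulfM !eF gmulfM conjM.
    apply: inj_surj_bij => [y z /(can_inj e'K) E|y].
      apply: (can_inj eK); apply: Sym_inj => x.
      have := congr1 (fun s => sval s (f x)) E.
      by rewrite /= fK => /(can_inj fK).
    pose s : Sym (S a) := exist _ (h \o sval (e y) \o f)
      (bij_comp (bij_comp (Bijective hK fK) (svalP (e y))) (Bijective fK hK)).
    exists (e' s); apply: (can_inj eK); rewrite eF e'K; apply: Sym_inj => x /=.
    by rewrite !hK.
  + move=> c cb x lcb; have ca := is_succ_le sab lcb.
    rewrite -(dmap_comp ca sab.1.1) Fdmap phiC; last exact: sab.1.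
    exact: dmap_comp.
  + move=> c scb y x.
    have E : c = a.
      exact: wle_anti (is_succ_le sab scb.1) (is_succ_le scb sab.1).
    subst c; rewrite (Prop_irrelevance scb sab) -/e eF.
    by rewrite /= -[phi a (t a * x)]/(f x) fK.
- have [a0 a0b] := is_limit_gt lb.
  have [|a ab|a ab|a a' aa x ab a'b|F FA FC] :=
    @direct_limit_aut _ S _ _ _ phi _ (rrs_limit hS lb).
  + by exists a0.
  + exact: dmap_inj hS _ _ _.
  + exact: phiA.
  + exact: phiC.
  exists F; split=> // [a ab x lab|a sab].
    by rewrite !(dmap_irr ab (proj1 lab)) FC.
  by case: lb => _ []; exists a.
Qed.

(** The recursion picks a twisted extension whenever there is one; induction then shows that there
    always is one. *)
Lemma twisted_family : exists phi : forall a, S a -> S a,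
  forall b, twisted_extension phi (phi b).
Proof.
(* [twisted_extension] expects a family on all of [kappa]; the identity fills the stages not below
   [b], which its conditions never consult. *)
pose ext b (r : forall a, wlt a b -> S a -> S a) a : S a -> S a :=
  match pselect (wlt a b) with left ab => r a ab | right _ => id end.
have : forall b (r : forall a, wlt a b -> S a -> S a), exists F : S b -> S b,
    (exists F' : S b -> S b,
      twisted_extension (ext b r) F') -> twisted_extension (ext b r) F.
  move=> b r; have [[F FP]|n] :=
    pselect (exists F' : S b -> S b, twisted_extension (ext b r) F').
    by exists F.
  (* Default value when no extension exists. *)
  by exists id.
move=> H; pose step b r := sval (cid (H b r)).
pose phi := Fix (@wlt_wf kappa) (fun a => S a -> S a) step.
have phiE b : phi b = step b (fun a _ => phi a).
  apply: (Fix_eq (@wlt_wf kappa) (fun a => S a -> S a) step) => a r r' rr'.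
  congr (step a _).
  by apply: functional_extensionality_dep => c;
    apply: functional_extensionality_dep.
have extE b (F : S b -> S b) : twisted_extension (ext b (fun a _ => phi a)) F ->
    twisted_extension phi F.
  have E a : wlt a b -> ext b (fun a _ => phi a) a = phi a.
    by rewrite /ext; case: pselect.
  move=> [FA FC FT]; split=> // [a ab x lab|a sab y x].
    by rewrite FC // E.
  by have := FT a sab y x; rewrite E //; exact: sab.1.
exists phi => b; elim/(well_founded_ind (@wlt_wf kappa)): b => b IH.
have stepP := svalP (cid (H b (fun a _ => phi a))).
rewrite [phi b]phiE; apply: extE; apply: stepP.
have E a : wlt a b -> ext b (fun a _ => phi a) a = phi a.
  by rewrite /ext; case: pselect.
apply: twisted_extension_exists => [a ab|a a' aa x a'b].
  by rewrite E //; have [] := IH a ab.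
rewrite !E //; last exact: wle_lt_trans aa a'b.
have [aa'|laa'] := wle_eqVlt aa; first by subst a'; rewrite !dmap_id.
by have [_ C _] := IH a' a'b; apply: C.
Qed.

End Automorphisms.

(** * As many automorphisms as subsets of the limit *)

Section ManyAutomorphisms.
Variables (kappa : wordinal) (G0 G : groupType) (S : directed_system kappa).
Variable g : forall a : kappa, [set: kappa] a -> {multiplicative S a -> G}.
Hypothesis hkappa : uncountable_cardinal kappa.
Hypothesis hS : regular_rep_system G0 S.
Hypothesis G03 : has_third G0.
Hypothesis gG : is_direct_limit g.
Implicit Types a b c : kappa.

Definition twisted_automorphism (t : forall a, S a) (F : G -> G) :=
  AutG G F /\ exists phi : forall a, S a -> S a,
    (forall b, twisted_extension hS t phi (phi b)) /\
    forall a x, F (g (a := a) I x) = g (a := a) I (phi a x).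

Lemma twisted_automorphism_exists t : exists F, twisted_automorphism t F.
Proof.
have [phi phiT] := twisted_family hS t.
have [|a []|a _|a b ab x _ _|F FA FC] := @direct_limit_aut _ S _ _ _ phi _ gG.
- exact: kappa_nonempty.
- exact: (colimit_inj hkappa hS gG).
- by have [] := phiT a.
- have [E|lab] := wle_eqVlt ab; first by subst b; rewrite !dmap_id.
  by have [_ C _] := phiT b; apply: C.
by exists F; split=> //; exists phi; split=> // a x; apply: FC.
Qed.

(** [F] determines the stage maps, hence the conjugations at the successor of [a]. If [t a] and
    [t' a] give the same one, left multiplication by [(t' a)^-1 * t a] commutes with every
    permutation of [S a], so it is the identity. *)
Lemma twisted_automorphism_inj t t' F :
  twisted_automorphism t F -> twisted_automorphism t' F -> forall a, t a = t' a.
Proof.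
move=> [_ [phi [phiT Fphi]]] [_ [phi' [phiT' Fphi']]] a.
have E b x : phi b x = phi' b x.
  by apply: (colimit_inj hkappa hS gG (a := b)); rewrite -Fphi -Fphi'.
have [b sab] := cardinal_succ hkappa a.
have [[phiB _] _ _] := phiT a.
have [inv phiK phiK'] := phiB.
have [_ _ T] := phiT b; have [_ _ T'] := phiT' b.
pose k x := (t' a)^-1 * (t a * x).
suff kid : k =1 id.
  by have := kid 1; rewrite /k mulg1 => /(congr1 (fun z => t' a * z));
    rewrite mulVKg mulg1.
apply: Sym_center_trivial; first exact: (stage_has_third hS G03 (a := a)).
move=> s x; rewrite /k /=.
have [e' _ e'K] := stage_iso_bij hS sab.
(* The point [k x] is chosen so that [t' a * k x = t a * x]; both twisting conditions then speak of
   the same value. *)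
have := T' a sab (e' s) (k x).
rewrite /k mulVKg -!E T e'K => /(can_inj phiK) ->.
by rewrite mulKg.
Qed.

(** The coordinate at the successor of [a] codes the trace of the subset on the infinite stage
    [S a]. *)
Lemma emb_set_stages : exists t : set G -> forall a, S a,
  forall A A', (forall a, t A a = t A' a) -> A = A'.
Proof.
have [a0 [_ natS]] := infinite_stage hkappa hS G03.
have H b : exists u : set G -> S b, forall a, is_succ a b -> wle a0 a ->
    forall A A', u A = u A' -> forall x : S a, A (g (a := a) I x) = A' (g (a :=
      a) I x).
  have [[a [sab a0a]]|n] := pselect (exists a, is_succ a b /\ wle a0 a);
    last first.
    (* Stages that are not successors of some [a >= a0] carry no information. *)
    by exists (fun=> 1) => a sab a0a; case: n; exists a.
  have [j jinj] := emb_set_succ hS (natS a a0a) sab.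
  exists (fun A => j (fun x => A (g (a := a) I x))) => c scb a0c A A' /jinj AA'.
  have E : c = a by exact: wle_anti (is_succ_le sab scb.1) (is_succ_le scb
    sab.1).
  by subst c => x; apply: (congr1 (fun B => B x) AA').
exists (fun A b => sval (cid (H b)) A) => A A' AA'; apply/funext => y.
have [a [x <-]] := colimit_surj hkappa gG y.
(* The element is pushed up to a stage [c] past [a0], whose trace is coded at the next stage. *)
have [c [ac a0c]] : exists c, wle a c /\ wle a0 c.
  by have [aa|aa] := orP (wle_total a a0); [exists a0|exists a]; split=> //;
    exact: wle_refl.
have [b scb] := cardinal_succ hkappa c.
by have := svalP (cid (H b)) c scb a0c A A' (AA' b) (dmap S ac x);
  rewrite (colimit_dmap gG).
Qed.

Lemma emb_set_aut : exists F : set G -> G -> G,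
  injective F /\ forall A, AutG G (F A).
Proof.
have [t tinj] := emb_set_stages.
have /choice[F FP] A := twisted_automorphism_exists (t A).
exists F; split=> [A A' E|A]; last by case: (FP A).
apply: tinj; apply: (twisted_automorphism_inj (FP A)); rewrite E; exact: FP.
Qed.

End ManyAutomorphisms.

Theorem corollary18 (kappa : wordinal) (G0 G : groupType)
    (hkappa : uncountable_cardinal kappa)
    (hG0 : `I_3 #<= [set: G0])
    (cG0 : countable [set: G0])
    (hG : limit_of_regular_reps kappa G0 G) :
  card_eq_beth (AutG G) (osucc kappa).
Proof.
have [S hS [g gG]] := hG; have G03 := I3_has_third hG0.
have GB := emb_colimit_beth_top hkappa hS cG0 gG.
have BG := emb_beth_colimit_top hkappa hS G03 gG.
exists (@beth (osucc (osucc kappa))); first exact: beth_familyP.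
have top_succ : @is_succ (osucc (osucc kappa)) (Some None) None.
  by split=> // -[[a|]|] [].
have setGB : emb (set G) (@beth (osucc (osucc kappa)) None).
  exact: emb_trans (emb_set GB) (emb_set_beth top_succ.1).
have BsetG : emb (@beth (osucc (osucc kappa)) None) (set G).
  exact: emb_trans (emb_beth_succ top_succ) (emb_set BG).
apply: Cantor_Bernstein.
  apply: card_le_trans (card_leT _) _; apply/emb_cardP.
  (* A self-map of [G] is a subset of [G * G], and [G * G] embeds in the infinite [G]. *)
  apply: emb_trans setGB; apply: (@emb_trans (set (G * G))).
    exists (fun f : G -> G => [set p | p.2 = f p.1]) => f f' E;
      apply/funext => x.
    have : [set p | p.2 = f p.1] (x, f x) by [].
    by rewrite E.
  apply/emb_set/emb_square; exact: emb_trans (emb_nat_beth _) BG.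
apply: (@card_le_trans _ _ _ [set: set G]); first exact/emb_cardP.
have [F [Finj FA]] := emb_set_aut hkappa hS G03 gG.
suff /injfunPex[F'] : exists2 f : set G -> G -> G,
    set_fun setT (AutG G) f & set_inj setT f.
  exact: inj_card_le F'.
by exists F => [A _|A A' _ _]; [apply: FA|apply: Finj].
Qed.
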